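(* Let $a,b\geq 2$ be integers. Let $J$ be the set of $x\in\mathbb{T}$ such that the sequence $\delta_{\times a,\times b,x}^N$ $(N\in\mathbb{N})$ does not converge (in the weak* topology) to any $\times a,\times b$ invariant Borel probability measure as $N\to\infty$. Then $$\dim_H J=1,$$ where $\dim_H$ denotes Hausdorff dimension.
   Context: $\mathbb{N}$ is the set of positive integers and $\mathbb{T}=\mathbb{R}/\mathbb{Z}$ with its standard metric. For an integer $c\ge 2$, $T_c:\mathbb{T}\to\mathbb{T}$ is $T_c(x)=cx$. $M(\mathbb{T})$ is the set of Borel probability measures on $\mathbb{T}$ with the weak* topology. A measure $\mu\in M(\mathbb{T})$ is $\times a,\times b$ invariant if it is invariant under both $T_a$ and $T_b$. For $x\in\mathbb{T}$ and $N\in\mathbb{N}$, the $N$-empirical measure of $x$ is $$\delta_{\times a,\times b,x}^N=\frac{1}{N^2}\sum_{m,n=0}^{N-1}\delta_{T_a^mT_b^nx}\in M(\mathbb{T}),$$ where $\delta_y$ is the probability measure supported on $\{y\}$. *)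

(* Defs.v *)
From HB Require Import structures.
From mathcomp Require Import all_boot all_order all_algebra.
From mathcomp Require Import generic_quotient ring_quotient archimedean.
From mathcomp Require Import all_classical all_reals all_analysis.
From mathcomp Require Import zify.

Set Implicit Arguments.
Unset Strict Implicit.
Unset Printing Implicit Defensive.

Import Order.TTheory GRing.Theory Num.Def Num.Theory.
Import numFieldNormedType.Exports.

Local Open Scope classical_set_scope.
Local Open Scope ring_scope.

Section hausdorff_dimension.
Context {R : realType} {X : metricType R}.
Implicit Types (s delta : R) (A : set X).

Definition diam A : \bar R := ereal_sup [set (mdist p.1 p.2)%:E | p in A `*` A].

(* The empty set gets weight 0 (also when s = 0), so that covers by sequences
   of sets include the finite ones. *)
Definition diam_pow s A : \bar R :=
  if A == set0 then 0%E else (diam A `^ s)%E.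

Definition hausdorff_premeasure s delta A : \bar R :=
  ereal_inf [set (\sum_(0 <= k <oo) diam_pow s (U k))%E |
    U in [set U : nat -> set X |
      A `<=` \bigcup_k U k /\ forall k, (diam (U k) <= delta%:E)%E]].

Definition hausdorff_measure s A : \bar R :=
  ereal_sup [set hausdorff_premeasure s delta A | delta in [set d : R | 0 < d]].

Definition hausdorff_dim A : \bar R :=
  ereal_inf [set s%:E | s in [set s : R | 0 <= s /\ hausdorff_measure s A = 0%E]].

End hausdorff_dimension.

(* R/Z as a quotient of additive groups: [Num.int_num_subdef] is the predicate
   behind [\is a Num.int], under which the subgroup structure is registered. *)
Definition torus (R : realType) : Type :=
  Quotient.quot (GRing.ZmodClosed.clone R (@Num.int_num_subdef R) _).

HB.instance Definition _ (R : realType) := ZmodQuotient.on (torus R).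
HB.instance Definition _ (R : realType) := isPointed.Build (torus R) 0.

Section torus_metric.
Context {R : realType}.
Implicit Types x y : torus R.

Lemma torus_piE (r s : R) :
  (\pi_(torus R) r == \pi_(torus R) s)%qT = (r - s \is a Num.int).
Proof. by rewrite -Quotient.idealrBE. Qed.

(* The quotient metric, i.e. the distance from any representative
   of x - y to the nearest integer. *)
Definition torus_dist x y : R :=
  inf [set `|r| | r in [set r : R | \pi_(torus R) r = x - y]%qT].

Let absreps x : set R := [set `|r| | r in [set r : R | \pi_(torus R) r = x]%qT].

Let absreps_neq0 x : absreps x !=set0.
Proof. by exists `|repr x|, (repr x) => //=; rewrite reprK. Qed.

Let absreps_ge0 x : lbound (absreps x) 0.
Proof. by move=> _ [r _ <-]. Qed.

Let absreps_inf x : has_inf (absreps x).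
Proof. by split => //; exists 0. Qed.

Let absreps_small x (e : R) : inf (absreps x) < e ->
  exists2 r : R, (\pi_(torus R) r)%qT = x & `|r| < e.
Proof.
rewrite -subr_gt0 => /(inf_adherent)/(_ (absreps_inf x))[_ [r rx <-]].
by rewrite subrKC => re; exists r.
Qed.

Let torus_distxx x : torus_dist x x = 0.
Proof.
rewrite /torus_dist subrr; apply/eqP; rewrite eq_le; apply/andP; split.
  apply: ge_inf; first by exists 0; exact: absreps_ge0.
  by exists 0; rewrite ?normr0//= raddf0.
exact: lb_le_inf (absreps_neq0 _) (@absreps_ge0 _).
Qed.

Let torus_dist_positivity x y : torus_dist x y = 0 -> x = y.
Proof.
move=> d0; apply/eqP; rewrite -subr_eq0; move: d0; rewrite /torus_dist.
move: (x - y) => z z0.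
have [|r rz r2] := @absreps_small z 2^-1; first by rewrite /absreps z0 invr_gt0.
have [r0|r0] := eqVneq r 0; first by rewrite -rz r0 raddf0.
have [|s sz sr] := @absreps_small z (`|r|).
  by rewrite /absreps z0 normr_gt0.
have : r - s \is a Num.int by rewrite -torus_piE rz sz.
move=> /intrP[n rsn].
have : `|r - s| < 1.
  by rewrite (le_lt_trans (ler_normB _ _))// [ltRHS]splitr ltrD// ?div1r// (lt_trans sr).
rewrite rsn -intr_norm ltrz1 => n1.
have n0 : n = 0 by lia.
by move: rsn; rewrite n0 => /eqP; rewrite subr_eq0 => /eqP rs; move: sr; rewrite rs ltxx.
Qed.

Let torus_dist_sym x y : torus_dist x y = torus_dist y x.
Proof.
rewrite /torus_dist; congr inf; apply/seteqP; split => [_ [r /= rxy <-]|_ [r /= rxy <-]];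
  by exists (- r); rewrite ?normrN//= raddfN/= rxy opprB.
Qed.

Let torus_dist_triangle y x z :
  torus_dist x z <= torus_dist x y + torus_dist y z.
Proof.
apply/ler_addgt0Pr => e e0.
have [|r rxy re] := @absreps_small (x - y) (torus_dist x y + e / 2).
  by rewrite ltrDl divr_gt0.
have [|s syz se] := @absreps_small (y - z) (torus_dist y z + e / 2).
  by rewrite ltrDl divr_gt0.
apply: (@le_trans _ _ `|r + s|).
  apply: ge_inf; first by exists 0; exact: absreps_ge0.
  by exists (r + s) => //=; rewrite raddfD/= rxy syz addrA subrK.
rewrite (le_trans (ler_normD _ _))// [e]splitr addrACA ltW//.
by rewrite ltrD.
Qed.

HB.instance Definition _ := @isMetric.Build R (torus R) torus_dist
  torus_distxx torus_dist_positivity torus_dist_sym torus_dist_triangle.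

Lemma torus_mdistE x y : mdist x y = torus_dist x y. Proof. by []. Qed.

End torus_metric.

(* The Borel sigma-algebra. *)
HB.instance Definition _ (R : realType) :=
  Measurable.copy (torus R) (g_sigma_algebraType (@open (torus R))).


Definition times {R : realType} (c : nat) (x : torus R) : torus R := x *+ c.

Section weak_star.
Context {R : realType}.

Definition weak_star_eval (f : continuousType (torus R) R)
    (mu : probability (torus R) R) : R :=
  \int[mu]_x f x.

(* The coarsest topology on M(T) for which every [weak_star_eval f] is
   continuous. *)
Definition weak_star_topology :=
  sup_topology (fun f : continuousType (torus R) R =>
    Topological.class (initial_topology (weak_star_eval f))).

HB.instance Definition _ :=
  Topological.copy (probability (torus R) R) weak_star_topology.

Lemma weak_star_cvgP (mu_ : nat -> probability (torus R) R)
    (mu : probability (torus R) R) :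
  mu_ @ \oo --> mu <->
  forall f : torus R -> R, continuous f ->
    \int[mu_ n]_x f x @[n --> \oo] --> \int[mu]_x f x.
Proof.
split=> [/cvg_sup mucvg f cf|mucvg].
  pose g : continuousType (torus R) R :=
    HB.pack_for (continuousType (torus R) R) f (isContinuous.Build _ _ f cf).
  have evg := @initial_continuous _ _ (weak_star_eval g) mu.
  move=> A /evg nA.
  exact: (mucvg g _ nA).
apply/cvg_sup => f A [_ [[B oB <-] Bmu BA]].
have /mucvg/(_ B) : continuous (f : torus R -> R) by exact: cts_fun.
have nB := open_nbhs_nbhs (conj oB Bmu).
by move=> /(_ nB) nBn; exact: (@filterS _ (mu_ @ \oo) _ _ _ BA nBn).
Qed.

End weak_star.

Definition times_invariant {R : realType} (c : nat)
    (mu : probability (torus R) R) : Prop :=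
  forall A : set (torus R), measurable A -> pushforward mu (times c) A = mu A.

Section empirical.
Context {R : realType} (a b : nat) (x : torus R).

(* A probability measure only for N >= 1: at N = 0 the weight is 0^-1 = 0. *)
Definition empirical_measure (N : nat) : set (torus R) -> \bar R :=
  mscale (N%:R ^- 2)%:nng
    (msum (fun m => msum (fun n => \d_(iter m (times a) (iter n (times b) x))) N) N).

HB.instance Definition _ (N : nat) := Measure.on (empirical_measure N).

Let empirical_measure_setT (N : nat) : empirical_measure N.+1 setT = 1%E.
Proof.
rewrite /empirical_measure /mscale/= /msum.
under eq_bigr => m _.
  rewrite /= /msum; under eq_bigr do rewrite /= diracT.
  rewrite sumEFin big_const_ord iter_addr_0.
  over.
rewrite sumEFin big_const_ord iter_addr_0 -EFinM -mulrnA -natrX mulnn.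
by rewrite mulVf// pnatr_eq0 expn_eq0.
Qed.

HB.instance Definition _ (N : nat) :=
  Measure_isProbability.Build _ _ _ (empirical_measure N.+1)
    (empirical_measure_setT N).

End empirical.

(* Main.v *)
Require Import Defs.
From HB Require Import structures.
From mathcomp Require Import all_boot all_order all_algebra.
From mathcomp Require Import generic_quotient archimedean.
From mathcomp Require Import all_classical all_reals all_analysis.
From mathcomp Require Import measurable_realfun.
From mathcomp Require Import zify ring lra.

(** The upper bound holds for every subset of the circle: [n] arcs of length
[1/n] cover it, so all Hausdorff measures of exponent [s > 1] vanish
([hausdorff_dim_torus_le1]).

For the lower bound, fix [s < 1] and an integer [q] with [s <= q / (q + 1)].
It suffices to find a set of points with divergent empirical measures that has
positive [s]-dimensional measure.  Take a real [u] in [[0, 1[] and insert runs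
of zeros into its base-[a] digits, at sparse places and so short that only a
proportion of about [1 / (q + 1)] of all digits is lost.  The resulting point
[psi u] ([padding]) has two competing features.

- At the end of a run, at time [N], a proportion of the pairs [(m, n)] in
[[0, N[^2] that is bounded below by a constant depending only on [b] and [q]
satisfies [a^m b^n (psi u)] close to [0]: write [psi u] as a fraction with
denominator a power of [a] plus a tiny remainder; the shift by [a^m] kills the
fraction, and the factor [b^n], which is at most [a^(b n)], needs time to blow
up the remainder ([bump_avg_near]).

- Long after a run and well before the next one, most [a^m b^n (psi u)] agree
modulo [1], up to a small error, with an integer multiple of [u].  For [u]
uniformly distributed each such multiple is uniformly distributed, so by
Markov's inequality the points of the orbit near [0] are rare for at least half
of all [u] ([typical_measure], [bump_avg_typical]).  The set of [u] for which
this happens at infinitely many scales still has measure at least [1/2]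
([limsup_measure_ge]).

For these [u] the averages of a bump function at [0] oscillate between two
values, so the empirical measures of [psi u] have no weak limit
([empirical_diverges]).  The map [psi] is increasing, and its inverse is Hölder
continuous of exponent [q / (q + 1)] ([padding_lower_holder]).  Hence the
preimages of a cover by sets of diameters [d_k] lie in intervals of lengths
proportional to [d_k^s], and the measure at least [1/2] of the set of good [u]
bounds the sum of the [d_k^s] from below ([hausdorff_measure_neq0]). *)

Set Implicit Arguments.
Unset Strict Implicit.
Unset Printing Implicit Defensive.

Import Order.TTheory GRing.Theory Num.Def Num.Theory.
Import numFieldNormedType.Exports.
Local Open Scope classical_set_scope.
Local Open Scope ring_scope.

(** * The projection of the line onto the circle *)

Section TorusProjection.
Context {R : realType}.
Implicit Types (r s : R) (x y : torus R).

Definition proj r : torus R := (\pi_(torus R) r)%qT.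

Lemma projB r s : proj (r - s) = proj r - proj s.
Proof. by rewrite /proj raddfB. Qed.

Lemma proj_eq r s : r - s \is a Num.int -> proj r = proj s.
Proof. by move=> rs; apply/eqP; rewrite /proj torus_piE. Qed.

Lemma proj_surj x : exists2 r, 0 <= r < 1 & proj r = x.
Proof.
exists (repr x - (Num.floor (repr x))%:~R).
  have /andP[] := floor_itv (repr x); rewrite intrD => ? ?.
  by apply/andP; split; lra.
rewrite -[RHS](reprK x); apply: proj_eq.
by rewrite addrAC subrr add0r rpredN intr_int.
Qed.

Let dist_lbound x y : has_lbound [set `|r| | r in [set r | \pi_(torus R) r = x - y]%qT].
Proof. by exists 0 => _ [r _ <-]. Qed.

Lemma mdist_proj_le r s : mdist (proj r) (proj s) <= `|r - s|.
Proof.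
rewrite torus_mdistE; apply: ge_inf; first exact: dist_lbound.
by exists (r - s) => //=; rewrite -projB.
Qed.

(** Up to distance [1/2] no nonzero integer translate can shorten the
difference, so the projection is a local isometry. *)
Lemma mdist_proj r s : `|r - s| <= 2^-1 -> mdist (proj r) (proj s) = `|r - s|.
Proof.
move=> rs; apply/eqP; rewrite eq_le mdist_proj_le torus_mdistE /=.
apply: lb_le_inf; first by exists `|r - s|, (r - s) => //=; rewrite -projB.
move=> _ [e /= + <-]; rewrite -projB => /eqP; rewrite torus_piE => /intrP[z ez].
have -> : e = z%:~R + (r - s) by rewrite -ez subrK.
have [->|z0] := eqVneq z 0; first by rewrite add0r.
have z1 : 1 <= `|z%:~R : R| by rewrite -intr_norm ler1z; lia.
have := lerB_normD (z%:~R : R) (r - s); lra.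
Qed.

(** The form in which closeness to [0] on the circle is used: the infimum that
defines the distance yields an actual nearby integer. *)
Lemma mdist_proj0_lt r e : mdist (proj r) 0 < e -> exists z : int, `|r - z%:~R| < e.
Proof.
have hi : has_inf [set `|r'| | r' in [set r' | \pi_(torus R) r' = proj r - 0]%qT].
  by split; [exists `|r|, r => //=; rewrite subr0|exact: dist_lbound].
rewrite torus_mdistE -subr_gt0 => /inf_adherent/(_ hi)[_ [s /= + <-]].
rewrite subrKC => + se.
rewrite subr0 => /eqP; rewrite torus_piE => /intrP[z sz].
exists (- z); rewrite intrN opprK; suff -> : r + z%:~R = s by [].
by rewrite -sz; ring.
Qed.

Lemma iter_times a b m n r :
  iter m (times a) (iter n (times b) (proj r)) = proj (a%:R ^+ m * b%:R ^+ n * r).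
Proof.
have it c i s : iter i (times c) (proj s) = proj (c%:R ^+ i * s).
  elim: i => [|i IH]; first by rewrite mul1r.
  by rewrite iterS IH /times /proj -raddfMn exprS -mulrA mulr_natl.
by rewrite !it mulrA.
Qed.

End TorusProjection.

(** * Subsets of the circle have dimension at most one *)

Section UpperBound.
Context {R : realType}.
Implicit Types (A : set (torus R)) (s : R).

(** [n] arcs of length [1/n] contribute [n * n^-s = n^-(s - 1)], which is
arbitrarily small because [s > 1]. *)
Lemma hausdorff_measure_torus0 A s : 1 < s -> hausdorff_measure s A = 0%E.
Proof.
move=> s1; have s0 : s != 0 by rewrite gt_eqF// (lt_trans ltr01).
have ge0 (U : nat -> set (torus R)) : (0 <= \sum_(0 <= k <oo) diam_pow s (U k))%E.
  apply: nneseries_ge0 => k _ _; rewrite /diam_pow.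
  by case: ifPn => // _; exact: poweR_ge0.
have small delta e : 0 < delta -> 0 < e -> (hausdorff_premeasure s delta A <= e%:E)%E.
  (* Arcs of length at most [e^(1 / (s - 1))] make the covering sum at most
     [e]. *)
  move=> d0 e0; pose m := Num.min delta (e `^ (s - 1)^-1).
  have m0 : 0 < m by rewrite lt_min d0 powR_gt0.
  pose n := (Num.bound m^-1).
  have mn : m^-1 < n%:R by apply: archi_boundP; rewrite invr_ge0 ltW.
  have n0 : (0 : R) < n%:R by apply: lt_trans mn; rewrite invr_gt0.
  have nm : (n%:R : R)^-1 <= m.
    by rewrite -[m]invrK lef_pV2 ?posrE ?invr_gt0// ltW.
  have n0' : (0 < n)%N by rewrite -(ltr0n R).
  pose U (k : nat) : set (torus R) := 
    if (k < n)%N then proj @` `[k%:R / n%:R, k.+1%:R / n%:R] else set0.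
  have dU k : (diam (U k) <= (n%:R^-1)%:E)%E.
    rewrite /U; case: ifPn => kn; last first.
      by apply: ge_ereal_sup => _ [[x y] [[]]].
    apply: ge_ereal_sup => _ [[x y] [/= [r + <-] [t + <-]] <-].
    rewrite /= !in_itv/= lee_fin => /andP[r0 r1] /andP[t0 t1].
    apply: (le_trans (mdist_proj_le _ _)); rewrite ler_norml.
    by move: r1 t1; rewrite -natr1 mulrDl mul1r => r1 t1; apply/andP; split; lra.
  apply: (@le_trans _ _ (\sum_(0 <= k <oo) diam_pow s (U k))%E).
    apply: ereal_inf_lbound; exists U => //; split; last first.
      move=> k; apply: (le_trans (dU k)); rewrite lee_fin (le_trans nm)//.
      by rewrite /m ge_min lexx.
    move=> x _; have [r /andP[r0 r1] <-] := proj_surj x.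
    have nr0 : 0 <= n%:R * r by rewrite mulr_ge0// ltW.
    exists (Num.trunc (n%:R * r)) => //; rewrite /U.
    have /andP[h1 h2] := truncn_itv nr0.
    have -> : (Num.trunc (n%:R * r) < n)%N.
      by rewrite -(ltr_nat R); apply: (le_lt_trans h1); rewrite gtr_pMr.
    exists r => //=; rewrite in_itv/= ler_pdivrMr// ler_pdivlMr// [r * _]mulrC h1/=.
    exact: ltW.
  rewrite (nneseries_split 0 n)//; last first.
    by move=> k _; rewrite /diam_pow; case: ifPn => // _; exact: poweR_ge0.
  rewrite add0n eseries0; last by move=> k nk _; rewrite /U ltnNge nk /diam_pow eqxx.
  rewrite adde0; apply: (@le_trans _ _ (\sum_(0 <= k < n) ((n%:R^-1 : R) `^ s)%:E)%E).
    apply: lee_sum => k _; rewrite /diam_pow; case: ifPn => [_|Uk].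
      by rewrite lee_fin powR_ge0.
    have [x Ux] : exists x, U k x by apply/set0P.
    have := dU k; have : (0 <= diam (U k))%E.
      by apply: ereal_sup_ubound; exists (x, x) => //=; rewrite mdistxx.
    case: (diam (U k)) => [d| |] //; rewrite poweR_EFin !lee_fin => d0' dn.
    apply: ge0_ler_powR; rewrite ?nnegrE ?invr_ge0 ?ler0n//.
    by rewrite ltW// (lt_trans ltr01).
  rewrite sumEFin lee_fin big_const_nat subn0 iter_addr_0 -[leLHS]mulr_natl.
  set x := (n%:R : R)^-1; have x0 : 0 < x by rewrite invr_gt0.
  have -> : n%:R * (x `^ s) = x `^ (s - 1).
    rewrite powRB// ?powRr1 ?(ltW x0)//; last by rewrite (gt_eqF x0) implybT.
    by rewrite mulrC /x invrK.
  apply: (@le_trans _ _ ((e `^ (s - 1)^-1) `^ (s - 1))).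
    apply: ge0_ler_powR; rewrite ?nnegrE ?powR_ge0 ?(ltW x0) ?subr_ge0 ?(ltW s1)//.
    by apply: (le_trans nm); rewrite /m ge_min lexx orbT.
  by rewrite -powRrM mulVf ?powRr1 ?(ltW e0)// subr_eq0 gt_eqF.
apply/eqP; rewrite eq_le; apply/andP; split.
  apply: ge_ereal_sup => _ [d /= d0 <-].
  by apply/lee_addgt0Pr => e e0; rewrite add0e small.
apply: (@le_trans _ _ (hausdorff_premeasure s 1 A)).
  by apply: le_ereal_inf_tmp => _ [U _ <-].
by apply: ereal_sup_ubound; exists 1 => //=.
Qed.

Lemma hausdorff_dim_torus_le1 A : (hausdorff_dim A <= 1)%E.
Proof.
apply/lee_addgt0Pr => e e0; apply: ereal_inf_lbound; exists (1 + e) => //=.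
split; first by rewrite addr_ge0// ltW.
by apply: hausdorff_measure_torus0; rewrite ltrDl.
Qed.

End UpperBound.

(** * A lower bound for Hausdorff measures *)

Section MassDistribution.
Context {R : realType} {X : metricType R}.
Local Notation mu := (@lebesgue_measure R).
Implicit Types (A U : set X) (s K c : R).

Lemma mdist_le_diam U x y : U x -> U y -> ((mdist x y)%:E <= diam U)%E.
Proof. by move=> Ux Uy; apply: ereal_sup_ubound; exists (x, y). Qed.

(** On a nonempty set of finite diameter the weight of a covering set is an
honest real power, which is the only case to treat in lower bounds. *)
Lemma diam_pow_fin s U x c : U x -> (diam U <= c%:E)%E ->
  exists d, [/\ 0 <= d, diam U = d%:E & diam_pow s U = (d `^ s)%:E].
Proof.
move=> Ux Uc; have U0 : (0 <= diam U)%E.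
  by apply: le_trans (mdist_le_diam Ux Ux); rewrite lee_fin mdist_ge0.
have Ufin : diam U \is a fin_num.
  by rewrite ge0_fin_numE//; apply: (le_lt_trans Uc); rewrite ltry.
exists (fine (diam U)); split; [exact: fine_ge0|by rewrite fineK|].
rewrite /diam_pow ifF; first by rewrite -[in LHS](fineK Ufin) poweR_EFin.
by apply/negP => /eqP U00; rewrite U00 in Ux.
Qed.

(** A mass distribution principle, with the mass carried over from Lebesgue
measure on [G] by [phi].  If the inverse of [phi] is [s]-Hölder, a set of
diameter [d] meets [phi @` G] in the image of a set contained in an interval of
length [2 K d^s]; countable subadditivity then bounds every covering sum below
by [c / (2 K)]. *)
Lemma hausdorff_measure_neq0 (phi : R -> X) (G : set R) A s K c :
  0 <= s -> 0 < K -> 0 < c -> measurable G -> (c%:E <= mu G)%E ->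
  phi @` G `<=` A ->
  (forall u v, G u -> G v -> `|u - v| <= K * mdist (phi u) (phi v) `^ s) ->
  hausdorff_measure s A <> 0%E.
Proof.
move=> s0 K0 c0 mG cG GA hol H0.
suff : ((c / (2 * K))%:E <= hausdorff_measure s A)%E.
  by rewrite H0 lee_fin leNgt divr_gt0// mulr_gt0.
apply: (@le_trans _ _ (hausdorff_premeasure s 1 A)); last first.
  by apply: ereal_sup_ubound; exists 1 => //=; exact: ltr01.
apply: le_ereal_inf_tmp => _ [U [AU dU] <-].
pose hit k := exists u, G u /\ U k (phi u).
(* The preimage of [U k] need not be measurable, so it is replaced by an
   interval around one of its points. *)
have Bex k : exists B : set R, [/\ measurable B,
    (mu B <= (2 * K)%:E * diam_pow s (U k))%E & G `&` phi @^-1` (U k) `<=` B].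
  have [[u [Gu Uu]]|nh] := pselect (hit k); last first.
    exists set0; split; [exact: measurable0| |by move=> v [Gv Uv]; apply: nh; exists v].
    rewrite measure0 mule_ge0//; first by rewrite lee_fin mulr_ge0// ltW.
    by rewrite /diam_pow; case: ifPn => // _; exact: poweR_ge0.
  have [d [d0 dE pE]] := diam_pow_fin s Uu (dU k).
  exists `[u - K * d `^ s, u + K * d `^ s]%classic; split.
  - exact: measurable_itv.
  - rewrite pE lebesgue_measure_itv/= lte_fin; case: ifPn => _.
      by rewrite -EFinB -EFinM lee_fin (_ : _ - _ = 2 * K * d `^ s)//; ring.
    by rewrite -EFinM lee_fin !mulr_ge0 ?powR_ge0// ltW.
  - move=> v [Gv Uv] /=; rewrite in_itv/= -ler_distlC distrC.
    apply: (le_trans (hol _ _ Gv Gu)); rewrite ler_pM2l// ge0_ler_powR// ?nnegrE ?mdist_ge0//.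
    by rewrite -lee_fin -dE mdist_le_diam.
have [B Bp] := choice Bex.
have : (c%:E <= \sum_(0 <= k <oo) ((2 * K)%:E * diam_pow s (U k)))%E.
  apply: (le_trans cG); apply: (@le_trans _ _ (\sum_(0 <= k <oo) mu (B k))%E).
    apply: measure_sigma_subadditive => //; first by move=> k; case: (Bp k).
    move=> u Gu; have [k _ Uk] : (\bigcup_k U k) (phi u) by apply: AU; apply: GA; exists u.
    by exists k => //; case: (Bp k) => _ _; apply.
  by apply: lee_nneseries => k *; [exact: measure_ge0|case: (Bp k)].
rewrite nneseriesZl; last first.
  by move=> k _; rewrite /diam_pow; case: ifPn => // _; exact: poweR_ge0.
move=> h; rewrite -(@lee_pmul2l _ (2 * K)%:E) ?lte_fin ?mulr_gt0// -EFinM.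
by rewrite mulrC divfK// gt_eqF// mulr_gt0.
Qed.

End MassDistribution.

(** * Inserting runs of zeros into digit expansions *)

Section Truncation.
Context {R : realType} (a : nat).
Hypothesis a2 : (2 <= a)%N.
Implicit Types (u v : R) (M N : nat).

Definition truncate N u : R := (Num.floor (a%:R ^+ N * u))%:~R / a%:R ^+ N.

Lemma expa_gt0 N : 0 < (a%:R : R) ^+ N.
Proof. by rewrite exprn_gt0// ltr0n; lia. Qed.

Lemma expa_neq0 N : (a%:R : R) ^+ N != 0.
Proof. by rewrite gt_eqF// expa_gt0. Qed.

Lemma expaV_gt0 N : 0 < ((a%:R : R) ^+ N)^-1.
Proof. by rewrite invr_gt0 expa_gt0. Qed.

Lemma expa_le M N : (M <= N)%N -> (a%:R : R) ^+ M <= a%:R ^+ N.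
Proof. by move=> MN; rewrite ler_eXn2l// ltr1n. Qed.

Lemma expaV_le M N : (M <= N)%N -> ((a%:R : R) ^+ N)^-1 <= (a%:R ^+ M)^-1.
Proof. by move=> MN; rewrite lef_pV2 ?posrE ?expa_gt0// expa_le. Qed.

Lemma expaD_div M N : (a%:R : R) ^+ (M + N) / a%:R ^+ N = a%:R ^+ M.
Proof. by rewrite exprD mulfK// expa_neq0. Qed.

Lemma truncate_le N u : truncate N u <= u.
Proof. by rewrite ler_pdivrMr ?expa_gt0// mulrC floor_le. Qed.

Lemma truncate_gt N u : u < truncate N u + (a%:R ^+ N)^-1.
Proof.
rewrite /truncate -[X in _ < _ + X]mul1r -mulrDl ltr_pdivlMr ?expa_gt0// mulrC.
by have := floorD1_gt (a%:R ^+ N * u); rewrite intrD.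
Qed.

Lemma truncate_homo N : {homo truncate N : u v / u <= v}.
Proof.
move=> u v uv; rewrite ler_pM2r ?expaV_gt0// ler_int; apply: le_floor.
by rewrite ler_pM2l ?expa_gt0.
Qed.

Lemma truncate_int N u : a%:R ^+ N * truncate N u \is a Num.int.
Proof. by rewrite mulrC divfK ?expa_neq0// intr_int. Qed.

Lemma truncate_homo_digits M N u : (M <= N)%N -> truncate M u <= truncate N u.
Proof.
move=> MN; rewrite ler_pdivlMr ?expa_gt0//.
have : truncate M u * a%:R ^+ N \is a Num.int.
  rewrite -(subnK MN) exprD mulrCA mulrC [truncate _ _ * _]mulrC.
  by rewrite rpredM ?truncate_int// rpredX// natr_int.
move=> /intrP[z zE]; rewrite zE ler_int floor_ge_int -zE mulrC.
by rewrite ler_pM2l ?expa_gt0// truncate_le.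
Qed.

Lemma truncate_ge0 N u : 0 <= u -> 0 <= truncate N u.
Proof.
by move=> u0; rewrite divr_ge0 ?(ltW (expa_gt0 _))// ler0z floor_ge0 mulr_ge0 ?(ltW (expa_gt0 _)).
Qed.

End Truncation.

Section ZeroRuns.
Context {R : realType} (a q : nat) (W : nat -> nat).
Hypothesis a2 : (2 <= a)%N.
Hypothesis Wlt : forall k, (W k < W k.+1)%N.
Implicit Types (u v : R) (k l : nat).

Let Wle k l : (k <= l)%N -> (W k <= W l)%N.
Proof. exact: (@homo_leq _ W leq leqnn leq_trans (fun i => ltnW (Wlt i))). Qed.

Definition cut k u : R := truncate a (q * W k) u.

(** The digits of [u] in the block between the places [q * W j] and
[q * W j.+1] are moved [W j] places to the right, so that
[W j.+1 - W j] zeros separate this block from the next one.  [padded k u] is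
the result for the first [k] blocks, and an initial block of [q * W 0] digits
preceded by [W 0] zeros. *)
Fixpoint padded k u : R :=
  if k is j.+1 then padded j u + (cut j.+1 u - cut j u) / a%:R ^+ W j
  else cut 0 u / a%:R ^+ W 0.

(** The partial expansions increase, so the full expansion is their
supremum. *)
Definition padding u : R := sup (range (padded ^~ u)).

Lemma cut_le k l u : (k <= l)%N -> cut k u <= cut l u.
Proof. by move=> kl; apply: truncate_homo_digits => //; rewrite leq_mul2l Wle ?orbT. Qed.

Lemma padded_le k l u : (k <= l)%N -> padded k u <= padded l u.
Proof.
apply: (nondecreasing_seqP (padded ^~ u)).1 => i.
by rewrite /= lerDl mulr_ge0 ?subr_ge0 ?cut_le// ltW ?expaV_gt0.
Qed.

(** From the [k]-th block on all digits are moved at least [W k] places. *)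
Lemma padded_le_tail k l u : (k <= l)%N ->
  padded l u <= padded k u + (cut l u - cut k u) / a%:R ^+ W k.
Proof.
move=> /subnK <-; elim: (l - k)%N => [|j IH]; first by rewrite subrr mul0r addr0.
rewrite addSn /=; apply: le_trans (lerD IH (lexx _)) _.
rewrite -addrA lerD2l.
have : (cut (j + k).+1 u - cut (j + k) u) / a%:R ^+ W (j + k) <=
       (cut (j + k).+1 u - cut (j + k) u) / a%:R ^+ W k.
  by rewrite ler_wpM2l ?subr_ge0 ?cut_le// expaV_le// Wle// leq_addl.
by rewrite !mulrBl; lra.
Qed.

(** The [k]-th partial expansion ends at the place [q * W k + W k.-1], where
the [k]-th run of zeros starts.  For [k = 0] the formula gives
[q * W 0 + W 0], because of the [W 0] leading zeros. *)
Lemma padded_int k u :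
  a%:R ^+ (q * W k + W k.-1) * padded k u \is a Num.int.
Proof.
have pint j k' e : (q * W j <= e)%N -> (k' <= e - q * W j)%N -> 
    a%:R ^+ e * (cut j u / a%:R ^+ k') \is a Num.int.
  move=> qe ke; rewrite -(subnK qe) exprD -(subnK ke) exprD.
  rewrite (_ : _ * _ = a%:R ^+ (e - q * W j - k') * (a%:R ^+ (q * W j) * cut j u)).
    by rewrite rpredM ?truncate_int// rpredX// natr_int.
  by field; exact: expa_neq0.
elim: k => [|k IH] /=; first by apply: pint; lia.
have qW : (q * W k <= q * W k.+1)%N by rewrite leq_mul2l Wle ?orbT.
have W' : (W k.-1 <= W k)%N by rewrite Wle// leq_pred.
rewrite mulrDr rpredD// ?mulrBl ?mulrBr ?rpredB//; [|apply: pint; lia|apply: pint; lia].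
have -> : (q * W k.+1 + W k = (q * W k.+1 + W k - (q * W k + W k.-1)) + (q * W k + W k.-1))%N by lia.
by rewrite exprD -mulrA rpredM// rpredX// natr_int.
Qed.

Lemma padded_ub k l u : 
  padded l u <= padded k u + (u - cut k u) / a%:R ^+ W k.
Proof.
have [kl|/ltnW lk] := leqP k l.
  apply: le_trans (padded_le_tail u kl) _.
  by rewrite lerD2l ler_pM2r ?expaV_gt0// lerB ?truncate_le.
apply: (le_trans (padded_le u lk)).
by rewrite lerDl mulr_ge0 ?subr_ge0 ?truncate_le// ltW ?expaV_gt0.
Qed.

Lemma padded_has_sup u : has_sup (range (padded ^~ u)).
Proof.
split; first by exists (padded 0 u); exists 0%N.
exists (padded 0 u + (u - cut 0 u) / a%:R ^+ W 0) => _ [l _ <-].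
exact: padded_ub.
Qed.

Lemma padded_le_padding k u : padded k u <= padding u.
Proof. by apply: sup_ubound; [case: (padded_has_sup u)|exists k]. Qed.

Lemma padding_le k u :
  padding u <= padded k u + (u - cut k u) / a%:R ^+ W k.
Proof.
apply: ge_sup; first by case: (padded_has_sup u).
by move=> _ [l _ <-]; exact: padded_ub.
Qed.

Lemma padding_ge0 u : 0 <= u -> 0 <= padding u.
Proof.
move=> u0; apply: le_trans (padded_le_padding 0 u).
by rewrite /= mulr_ge0 ?truncate_ge0// ltW ?expaV_gt0.
Qed.

(** Keeping the values in [[0, 1/2]] makes distances on the circle equal to
distances on the line. *)
Lemma padding_le_half u : (0 < W 0)%N -> 0 <= u <= 1 -> padding u <= 2^-1.
Proof.
move=> W0 /andP[u0 u1]; apply: (le_trans (padding_le 0 u)) => /=.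
rewrite -mulrDl subrKC; apply: (@le_trans _ _ (1 * (a%:R ^+ 1)^-1)).
  apply: ler_pM => //; last exact: expaV_le.
by rewrite mul1r expr1 lef_pV2 ?posrE ?ltr0n ?ler_nat//; lia.
Qed.

(** The [k]-th run of zeros ends at the place [q.+1 * W k]. *)
Lemma padding_sub_padded k u :
  0 <= padding u - padded k u <= (a%:R ^+ (q.+1 * W k))^-1.
Proof.
rewrite subr_ge0 padded_le_padding /= lerBlDl.
apply: (le_trans (padding_le k u)); rewrite lerD2l mulSn addnC exprD invfM.
rewrite ler_pM2r ?expaV_gt0// lerBlDl ltW//; exact: truncate_gt.
Qed.

(** Summation by parts writes a partial expansion as a combination of
truncations of [u], with the coefficients
[a^(- W j) - a^(- W j.+1)], plus a last term.  All coefficients are nonnegative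
and truncations are monotone in [u], so for [u <= v] the difference is at least
any one of the terms; in the proof, [D] is the sum without the last term. *)
Lemma padded_gap j l u v : u <= v -> (j < l)%N ->
  (cut j.+1 v - cut j.+1 u) / (2 * a%:R ^+ W j) <= padded l v - padded l u.
Proof.
move=> uv jl.
pose D l := padded l v - padded l u - (cut l v - cut l u) / a%:R ^+ W l.
have pge0 i : 0 <= cut i v - cut i u by rewrite subr_ge0 truncate_homo.
have DS i : D i.+1 = D i + (cut i.+1 v - cut i.+1 u) *
    ((a%:R ^+ W i)^-1 - (a%:R ^+ W i.+1)^-1).
  by rewrite /D /=; ring.
have Dle i : D i <= D i.+1.
  by rewrite DS lerDl mulr_ge0// subr_ge0 expaV_le// ltnW.
have Dge0 i : 0 <= D i.
  elim: i => [|i IH]; last exact: le_trans IH (Dle i).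
  by rewrite /D /= -mulrBl subrr.
apply: (@le_trans _ _ (D l)); last first.
  by rewrite /D gerBl mulr_ge0// ltW ?expaV_gt0.
apply: (@le_trans _ _ (D j.+1)); last first.
  exact: (nondecreasing_seqP D).1.
rewrite DS -[leLHS]add0r lerD// ler_wpM2l//.
have h : (a%:R ^+ W j.+1)^-1 <= (2 * a%:R ^+ W j)^-1 :> R.
  rewrite lef_pV2 ?posrE ?mulr_gt0 ?expa_gt0//.
  apply: le_trans (@expa_le R _ a2 (W j).+1 _ _) => //.
  by rewrite exprS ler_pM2r ?expa_gt0// ler_nat.
rewrite lerBrDr; apply: le_trans (lerD (lexx _) h) _.
by rewrite invfM -mulr2n -mulr_natr; lra.
Qed.

Lemma padding_gap j u v : u <= v ->
  (cut j.+1 v - cut j.+1 u) / (2 * a%:R ^+ W j) <= padding v - padding u.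
Proof.
move=> uv; rewrite lerBrDr -lerBrDl; apply: ge_sup; first by case: (padded_has_sup u).
move=> _ [l _ <-]; rewrite lerBrDl -lerBrDr.
apply: (le_trans (padded_gap uv (leq_maxr l j.+1))).
by rewrite lerB ?padded_le_padding// padded_le// leq_maxl.
Qed.

(** Padding shrinks an increment [t] at the scale of the [j]-th block by a factor
of at least [a^(- W j)], up to a constant, while [t] is at most about
[a^(- q * W j)]; so the increment of [padding] is at least of the order of
[t^(1 + 1/q)].  The inequality is raised to the power [q] in order to stay with
natural exponents. *)
Lemma padding_lower_holder u v : (0 < q)%N -> u <= v -> v - u <= 1 ->
  ((v - u) / 2) ^+ q.+1 <= a%:R ^+ (q * W 0) * (2 * (padding v - padding u)) ^+ q.
Proof.
move=> q0 uv vu1; set t := (v - u) / 2; set g := padding v - padding u.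
have g0 : 0 <= g.
  apply: le_trans (padding_gap 0 uv).
  by rewrite mulr_ge0 ?subr_ge0 ?truncate_homo// invr_ge0 mulr_ge0// ltW ?expa_gt0.
have : 0 <= t by rewrite /t; lra.
rewrite le_eqVlt => /predU1P[<-|t0].
  by rewrite expr0n mulr_ge0 ?exprn_ge0 ?mulr_ge0.
(* The least such [j] is the first block whose digits separate [u] from [v]
   clearly. *)
have ex : exists j, (a%:R ^+ (q * W j.+1))^-1 <= t.
  exists (Num.bound t^-1); rewrite -[t in _ <= t]invrK lef_pV2 ?posrE ?expa_gt0 ?invr_gt0//.
  apply: ltW; apply: lt_le_trans (upper_nthrootP (leqnn _)) _.
  have idW j : (j <= W j)%N by elim: j => // j IH; exact: leq_ltn_trans (Wlt j).
  apply: (@le_trans _ _ (a%:R ^+ Num.bound t^-1)).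
    by apply: lerXn2r; rewrite ?nnegrE ?ler0n ?ler_nat.
  apply: expa_le => //; apply: leq_trans (leq_pmull _ q0).
  exact: ltnW (idW _).
case: (ex_minnP ex) => j jt jmin.
have tW : t <= a%:R ^+ W j * (2 * g).
  have := padding_gap j uv; rewrite -/g ler_pdivrMr ?mulr_gt0 ?expa_gt0// => h.
  have := truncate_gt a2 (q * W j.+1) v; have := truncate_le a2 (q * W j.+1) u.
  move: h jt; rewrite /cut /t; set A := a%:R ^+ W j.
  rewrite mulrCA (mulrC A) [2 * _ in X in _ -> _ -> _ -> _ -> _ <= X]mulrC.
  lra.
have tWj : t * a%:R ^+ (q * W j) <= a%:R ^+ (q * W 0).
  case: j {tW jt} jmin => [|j] jmin; first by rewrite ler_piMl ?(ltW (expa_gt0 _ _))//; rewrite /t; lra.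
  have : t < (a%:R ^+ (q * W j.+1))^-1.
    by rewrite ltNge; apply/negP => /jmin; rewrite ltnn.
  rewrite -[X in _ < X -> _]mul1r ltr_pdivlMr ?expa_gt0// => /ltW /le_trans; apply.
  exact: (@expa_le _ _ a2 0).
rewrite exprS; apply: (@le_trans _ _ (t * (a%:R ^+ W j * (2 * g)) ^+ q)).
  by rewrite ler_pM2l// lerXn2r// nnegrE ?(ltW t0)// (le_trans (ltW t0)).
by rewrite exprMn -exprM mulrA mulnC ler_wpM2r// exprn_ge0// mulr_ge0.
Qed.
End ZeroRuns.

(** * Lebesgue measure and counting *)

Section Lebesgue.
Context {R : realType}.
Implicit Types (u e : R) (c : nat).
Local Notation mu := (@lebesgue_measure R).

(** [near_int c e] covers the [u] in [[0, 1[] for which [c * u] is within [e] of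
an integer [z]; then [u] is within [e / c] of [z / c], with [0 <= z <= c].  An
explicit finite union of intervals makes measurability immediate. *)
Definition near_frac c e (z : nat) : set R :=
  `](z%:R - e) / c%:R, (z%:R + e) / c%:R[%classic.

Definition near_int c e : set R := \big[setU/set0]_(z < c.+1) near_frac c e z.

Lemma measurable_near_int c e : measurable (near_int c e).
Proof. by apply: bigsetU_measurable => z _; exact: measurable_itv. Qed.

(** There are [c + 1] intervals of length [2 e / c], and [c + 1 <= 2 c]. *)
Lemma mu_near_int c e : (0 < c)%N -> 0 <= e -> (mu (near_int c e) <= (4 * e)%:E)%E.
Proof.
move=> c0 e0.
apply: (@le_trans _ _ (\sum_(z < c.+1) mu (near_frac c e z))%E).
  apply: (content_subadditive mu (F := near_frac c e)).
  - by move=> z _; exact: measurable_itv.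
  - exact: measurable_near_int.
  - by [].
apply: (@le_trans _ _ (\sum_(z < c.+1) (2 * e / c%:R)%:E)%E).
  apply: lee_sum => z _; rewrite [mu _]lebesgue_measure_itv/=; case: ifPn => _.
    by rewrite -EFinB lee_fin -mulrBl (_ : _ - _ = 2 * e)//; ring.
  by rewrite lee_fin divr_ge0 ?mulr_ge0.
rewrite sumEFin lee_fin sumr_const card_ord -[leLHS]mulr_natr.
have cR : 0 < c%:R :> R by rewrite ltr0n.
apply: (@le_trans _ _ (2 * e / c%:R * (2 * c%:R))).
  by rewrite ler_wpM2l ?divr_ge0 ?mulr_ge0// -natrM ler_nat; lia.
by rewrite le_eqVlt; apply/predU1P; left; field; rewrite gt_eqF.
Qed.

Lemma near_intP c e u (z : int) : 0 <= u < 1 -> 0 < e <= 1 -> (0 < c)%N ->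
  `|c%:R * u - z%:~R| < e -> near_int c e u.
Proof.
move=> /andP[u0 u1] /andP[e0 e1] c0; rewrite ltr_norml => /andP[h1 h2].
have c0' : 0 < c%:R :> R by rewrite ltr0n.
have cu1 : c%:R * u < c%:R by rewrite gtr_pMr.
have cu0 : 0 <= c%:R * u by rewrite mulr_ge0// ltW.
have zN1 : -1 < z by rewrite -(ltr_int R) intrN; lra.
have zc : z < c.+1%:Z by rewrite -(ltr_int R) -[c.+1%:~R]/(c.+1%:R) -natr1; lra.
case: z h1 h2 zN1 zc => [z|//] h1 h2 _ zc.
have {}zc : (z < c.+1)%N by lia.
rewrite /near_int -(bigcup_mkord _ (near_frac c e)).
exists z => //=; rewrite /near_frac/= in_itv/= ltr_pdivrMr// ltr_pdivlMr//.
move: h1 h2; rewrite -[z%:~R]/(z%:R) mulrC => h1 h2.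
by apply/andP; split; lra.
Qed.

(** The expected number of events [F i] that contain [u] is at most
[e * size s], so by Markov's inequality at most half of the unit interval sees
twice that number. *)
Lemma markov_count (I : Type) (s : seq I) (F : I -> set R) e :
  (0 < size s)%N -> 0 < e -> (forall i, measurable (F i)) ->
  (forall i, (mu (F i) <= e%:E)%E) ->
  let G := `[0, 1[%classic `&` [set u | \sum_(i <- s) \1_(F i) u < 2 * e * (size s)%:R] in
  measurable G /\ ((2^-1)%:E <= mu G)%E.
Proof.
move=> s0 e0 mF muF; set D : set R := `[0, 1[%classic.
set t := 2 * e * (size s)%:R.
have t0 : 0 < t by rewrite !mulr_gt0// ltr0n.
pose f u : R := \sum_(i <- s) \1_(F i) u; move=> G.
have mf : measurable_fun D (EFin \o f).
  apply/measurable_EFinP; apply: measurable_sum => i.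
  exact: measurable_indic.
have mD : measurable D by exact: measurable_itv.
have muD : mu D = 1%E by rewrite [mu _]lebesgue_measure_itv/= lte_fin ltr01 oppr0 adde0.
have f0 u : 0 <= f u by apply: sumr_ge0.
pose B := D `&` [set u | (t%:E <= `|(EFin \o f) u|)%E].
have GB : G = D `\` B.
  apply/seteqP; split => u /=; rewrite /B /G /= lee_fin ger0_norm//.
    by move=> [Du fu]; split=> // -[_]; rewrite leNgt fu.
  by move=> [Du nB]; split => //; rewrite ltNge; apply/negP => ?; apply: nB.
have mB : measurable B.
  apply: (measurable_lee mD (f := cst t%:E) (g := fun u => `|(EFin \o f) u|%E)); first exact: measurable_cst.
  exact: measurableT_comp.
have iB : (t%:E * mu B <= (e * (size s)%:R)%:E)%E.
  apply: (le_trans (le_integral_abse mu mD mf t0)).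
  under eq_integral do rewrite /= ger0_norm// -sumEFin.
  rewrite ge0_integral_sum//=; last first.
    by move=> i; apply/measurable_EFinP; apply: measurable_indic; exact: mF.
  apply: (@le_trans _ _ (\sum_(i <- s) e%:E)%E).
    apply: lee_sum => i _; rewrite integral_indic//; last exact: mF.
    apply: le_trans (muF i); apply: le_measure; last exact: subIsetl.
      by rewrite inE; exact: measurableI (mF i) mD.
    by rewrite inE; exact: mF.
  by rewrite sumEFin big_const_seq count_predT iter_addr_0 mulr_natr.
have muB : (mu B <= (2^-1)%:E)%E.
  rewrite -(@lee_pmul2l _ t%:E) ?lte_fin//; apply: (le_trans iB).
  by rewrite -EFinM lee_fin /t; lra.
split; first by rewrite GB; exact: measurableD.
have DB : D `&` B = B by rewrite setIidr// => ? [].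
have -> : mu G = (1 - mu B)%E.
  have fD : (mu D < +oo)%E by rewrite muD ltry.
  by rewrite GB (measureD (mu := mu) mD mB fD) DB; congr (_ - _)%E; exact: muD.
rewrite leeBrDr; last by rewrite ge0_fin_numE// (le_lt_trans muB)// ltry.
apply: le_trans (leeD (lexx _) muB) _.
by rewrite -EFinD lee_fin; lra.
Qed.

(** The unions over [k >= n] decrease with [n], and each of them has measure at
least [e]; the finite measure of the interval gives continuity from above. *)
Lemma limsup_measure_ge (G : nat -> set R) e :
  (forall k, measurable (G k)) -> (forall k, G k `<=` `[0, 1[%classic) ->
  (forall k, (e%:E <= mu (G k))%E) -> (e%:E <= mu (lim_sup_set G))%E.
Proof.
move=> mG GD eG.
have mU n : measurable (\bigcup_(k in [set k | (n <= k)%N]) G k) by exact: bigcup_measurable.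
have fin : (mu (\bigcup_(k in [set k | (0 <= k)%N]) G k) < +oo)%E.
  apply: (@le_lt_trans _ _ (mu `[0, 1[%classic)).
    apply: le_measure; last exact: bigcup_sub.
      by rewrite inE; exact: mU.
    by rewrite inE; exact: measurable_itv.
  by rewrite lebesgue_measure_itv/= lte_fin ltr01 oppr0 adde0 ltry.
apply: cvge_to_ge (lim_sup_set_cvg mu G mG fin) _.
apply: nearW => n; apply: (le_trans (eG n)); apply: le_measure.
- by rewrite inE; exact: mG.
- by rewrite inE; exact: mU.
- by move=> u Gu; exists n => /=.
Qed.

End Lebesgue.

(** * A test function and its empirical averages *)

Section Bump.
Context {R : realType}.
Implicit Types (rho : R) (x y : torus R).

(** Lipschitz tent of height [1] and radius [rho] around [0]. *)
Definition bump rho x : R := Num.max 0 (1 - mdist x 0 / rho).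

Lemma bump_ge0 rho x : 0 <= bump rho x.
Proof. by rewrite le_max lexx. Qed.

Lemma bump_le1 rho x : 0 < rho -> bump rho x <= 1.
Proof. by move=> r0; rewrite ge_max ler01/= gerBl divr_ge0 ?mdist_ge0// ltW. Qed.

Lemma bump_near rho x : 0 < rho -> mdist x 0 <= rho / 2 -> 2^-1 <= bump rho x.
Proof.
move=> r0 xr; rewrite le_max; apply/orP; right.
have : mdist x 0 / rho <= 2^-1 by rewrite ler_pdivrMr// mulrC.
lra.
Qed.

Lemma bump_far rho x : 0 < rho -> rho <= mdist x 0 -> bump rho x = 0.
Proof.
move=> r0 xr; apply/max_idPl; rewrite subr_le0 ler_pdivlMr// mul1r//.
Qed.

Lemma bump_lipschitz rho x y : 0 < rho -> `|bump rho x - bump rho y| <= mdist x y / rho.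
Proof.
move=> r0; have half s t : bump rho s - bump rho t <= mdist s t / rho.
  rewrite lerBlDr ge_max; apply/andP; split.
    by rewrite addr_ge0 ?bump_ge0// divr_ge0 ?mdist_ge0// ltW.
  have : 1 - mdist t 0 / rho <= bump rho t by rewrite le_max lexx orbT.
  have : mdist t 0 / rho <= mdist s t / rho + mdist s 0 / rho.
    by rewrite -mulrDl ler_pM2r ?invr_gt0// [mdist s t]metric_sym metric_triangle.
  lra.
rewrite ler_norml half andbT; have := half y x; rewrite metric_sym; lra.
Qed.

Lemma continuous_bump rho : 0 < rho -> continuous (bump rho).
Proof.
move=> r0 x; apply: (proj2 (cvgrPdist_lt (F := nbhs x) (fun y => bump rho y) (bump rho x))) => e e0.
apply/nbhs_ballP; exists (e * rho); first by rewrite /= mulr_gt0.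
move=> y; rewrite ballEmdist => xy; apply: (le_lt_trans (bump_lipschitz x y r0)).
by rewrite ltr_pdivrMr.
Qed.

End Bump.

Section EmpiricalIntegral.
Context {R : realType} (a b : nat) (x : torus R).

Lemma measurable_continuous_torus (f : torus R -> R) : continuous f ->
  measurable_fun [set: torus R] f.
Proof.
move=> cf; apply: (measurability _ (measurable_realfun.RGenOpens.measurableE R)).
move=> _ [_ [r [s ->] <-]]; rewrite setTI; apply: sub_sigma_algebra.
by move/continuousP: cf; apply; exact: interval_open.
Qed.

Lemma Rintegral_empirical (f : torus R -> R) N : continuous f -> (forall y, 0 <= f y) ->
  \int[empirical_measure a b x N]_y f y =
  N%:R ^- 2 * \sum_(m < N) \sum_(n < N) f (iter m (times a) (iter n (times b) x)).
Proof.
move=> cf f0.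
have mf : measurable_fun [set: torus R] (EFin \o f).
  by apply/measurable_EFinP; exact: measurable_continuous_torus.
have f0E : forall y, [set: torus R] y -> (0 <= (EFin \o f) y)%E.
  by move=> y _; rewrite lee_fin.
have inner (m : nat) : (\int[msum (fun n => \d_(iter m (times a) (iter n (times b) x))) N]_y
    (EFin \o f) y = (\sum_(n < N) f (iter m (times a) (iter n (times b) x)))%:E)%E.
  rewrite ge0_integral_measure_sum// -sumEFin; apply: eq_bigr => n _.
  by rewrite integral_dirac//= diracT mul1e.
rewrite /Rintegral /empirical_measure ge0_integral_mscale// ge0_integral_measure_sum//.
by under eq_bigr => m _ do rewrite inner; rewrite sumEFin.
Qed.

End EmpiricalIntegral.

(** * Orbits of padded points *)

(** The [k]-th run of zeros extends from about [q * scale b k] to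
[q.+1 * scale b k].  Factorials make consecutive scales diverge in ratio, and
[k.+1`!] rather than [k`!] makes the sequence strictly increasing from the start.
The factor [4 * b] makes the sides [b * side k] and [side k] of the boxes of
exponents that occur below integral fractions of the run. *)
Definition side (k : nat) : nat := k.+1`!.

Lemma side_gt0 k : (0 < side k)%N.
Proof. exact: fact_gt0. Qed.

Lemma sideS k : side k.+1 = (k.+2 * side k)%N.
Proof. by rewrite /side factS. Qed.

Lemma ltn_side k : (k < side k)%N.
Proof. by elim: k => // k IH; rewrite sideS; have := side_gt0 k; nia. Qed.

Definition scale (b k : nat) : nat := 4 * b * side k.

Lemma scale_ltS b k : (0 < b)%N -> (scale b k < scale b k.+1)%N.
Proof. by rewrite /scale sideS; have := side_gt0 k; nia. Qed.

Section Oscillation.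
Context {R : realType} (a b q : nat).
Hypothesis a2 : (2 <= a)%N.
Hypothesis b2 : (2 <= b)%N.
Implicit Types (u rho : R) (k m n h : nat).

Local Notation scale := (scale b).
Local Notation psi := (padding a q scale).

Let scale_lt k : (scale k < scale k.+1)%N.
Proof. by apply: scale_ltS; apply: ltnW. Qed.

(** [b <= a^b] turns powers of [b] into powers of [a]. *)
Lemma monomial_le m n : (a%:R : R) ^+ m * b%:R ^+ n <= a%:R ^+ (m + b * n).
Proof.
rewrite exprD ler_pM2l ?expa_gt0// exprM lerXn2r ?nnegrE ?exprn_ge0//.
by rewrite -natrX ler_nat ltnW// ltn_expl.
Qed.

Lemma monomial_div_le m n h e : (m + b * n + h <= e)%N ->
  (a%:R : R) ^+ m * b%:R ^+ n / a%:R ^+ e <= (a%:R ^+ h)^-1.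
Proof.
move=> le_e; rewrite ler_pdivrMr ?expa_gt0//.
apply: (le_trans (monomial_le m n)).
have he : (h <= e)%N by apply: leq_trans le_e; rewrite leq_addl.
rewrite mulrC -{1}(subnK he) expaD_div//; apply: expa_le => //.
by rewrite leq_subRL// addnC.
Qed.

(** The part of the expansion before the [k]-th run becomes an integer, and the
part after the run is still small after multiplication by [a^m b^n]. *)
Lemma mdist_monomial_near m n k u (h : nat) : (q * scale k + scale k.-1 <= m)%N ->
  (m + b * n + h <= q.+1 * scale k)%N ->
  mdist (proj (a%:R ^+ m * b%:R ^+ n * psi u)) 0 <= (a%:R ^+ h)^-1.
Proof.
move=> Lm mnh; have /andP[e0 e1] := padding_sub_padded q a2 scale_lt k u (R := R).
set e := psi u - _ in e0 e1.
have -> : proj (a%:R ^+ m * b%:R ^+ n * psi u) = proj (a%:R ^+ m * b%:R ^+ n * e).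
  apply: proj_eq; rewrite -mulrBr /e subKr mulrAC rpredM ?rpredX ?natr_int//.
  rewrite -(subnK Lm) exprD -mulrA rpredM ?rpredX ?natr_int//.
  exact: padded_int a2 scale_lt _ _.
have -> : 0 = proj (0 : R) by rewrite /proj raddf0.
apply: (le_trans (mdist_proj_le _ _)); rewrite subr0 ger0_norm; last first.
  by rewrite !mulr_ge0 ?exprn_ge0.
apply: le_trans (monomial_div_le mnh).
by rewrite ler_wpM2l// mulr_ge0 ?exprn_ge0.
Qed.

(** Between two runs the expansion of [psi u] is a shifted copy of that of [u].
Hence multiplication by [a^m], with [m] beyond the [k]-th run, acts like
multiplication of [u] by [a^(m - scale k)], up to an integer and up to an error
from the digits after the next run. *)
Lemma monomial_padding_approx m n k u h : (q.+1 * scale k <= m)%N ->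
  (m + b * n + h <= q * scale k.+1)%N -> 0 <= u ->
  exists2 z : R, z \is a Num.int &
    `|a%:R ^+ m * b%:R ^+ n * psi u - z - (a ^ (m - scale k) * b ^ n)%:R * u| <= (a%:R ^+ h)^-1.
Proof.
move=> Lm mnh u0; have /andP[] := padding_sub_padded q a2 scale_lt k.+1 u (R := R).
set e := psi u - _ => e0 e1.
pose P : R := padded a q scale k u; pose c := cut a q scale k u.
pose c' := cut a q scale k.+1 u.
have eE : e = psi u - (P + (c' - c) / a%:R ^+ scale k) by [].
have km : (scale k <= m)%N by apply: leq_trans Lm; rewrite leq_pmull.
have scale1 : (scale k.-1 <= scale k)%N by case: (k) => //= j; exact: ltnW (scale_lt _).
exists (a%:R ^+ m * b%:R ^+ n * P - a%:R ^+ (m - scale k) * b%:R ^+ n * c).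
  apply: rpredB.
    rewrite mulrAC rpredM ?rpredX ?natr_int//.
    have Lm' : (q * scale k + scale k.-1 <= m)%N by apply: leq_trans Lm; rewrite mulSn addnC leq_add2r.
    rewrite -(subnK Lm') exprD -mulrA rpredM ?rpredX ?natr_int//.
    exact: padded_int a2 scale_lt _ _.
  rewrite mulrAC rpredM ?rpredX ?natr_int//.
  have Lm' : (q * scale k <= m - scale k)%N by rewrite leq_subRL// -mulSn.
  rewrite -(subnK Lm') exprD -mulrA rpredM ?rpredX ?natr_int//.
  exact: truncate_int.
have t0 : 0 <= u - c' by rewrite subr_ge0 truncate_le.
have t1 : u - c' <= (a%:R ^+ (q * scale k.+1))^-1.
  by rewrite lerBlDl ltW// truncate_gt.
set M := (a ^ (m - scale k) * b ^ n)%:R : R.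
have ME : M = a%:R ^+ (m - scale k) * b%:R ^+ n by rewrite /M natrM !natrX.
(* The error is the difference of two small nonnegative terms: the contribution
   of the later blocks to [psi u], and that of the later digits of [u]. *)
have -> : a%:R ^+ m * b%:R ^+ n * psi u - (a%:R ^+ m * b%:R ^+ n * P -
    a%:R ^+ (m - scale k) * b%:R ^+ n * c) - M * u =
    a%:R ^+ m * b%:R ^+ n * e - M * (u - c').
  have aE : (a%:R : R) ^+ m = a%:R ^+ (m - scale k) * a%:R ^+ scale k.
    by rewrite -exprD subnK.
  rewrite eE ME aE; field; exact: expa_neq0.
have h1 : 0 <= a%:R ^+ m * b%:R ^+ n * e <= (a%:R ^+ h)^-1.
  rewrite !mulr_ge0 ?exprn_ge0//=; apply: le_trans (monomial_div_le mnh).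
  rewrite ler_wpM2l// ?mulr_ge0 ?exprn_ge0//; apply: (le_trans e1).
  by apply: expaV_le => //; rewrite mulSn leq_addl.
have h2 : 0 <= M * (u - c') <= (a%:R ^+ h)^-1.
  rewrite ME !mulr_ge0 ?exprn_ge0//=.
  apply: le_trans (@monomial_div_le (m - scale k) n h (q * scale k.+1) _); last by lia.
  by rewrite ler_wpM2l// ?mulr_ge0 ?exprn_ge0.
move: h1 h2 => /andP[? ?] /andP[? ?]; rewrite ler_norml; apply/andP; split; lra.
Qed.

(** Where the bump does not vanish the orbit point is within [rho] of [0]; the
approximation by a multiple of [u] costs another [rho]. *)
Lemma bump_le_indic m n k u h rho : (q.+1 * scale k <= m)%N ->
  (m + b * n + h <= q * scale k.+1)%N -> 0 <= u < 1 -> (a%:R ^+ h)^-1 <= rho ->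
  2 * rho <= 1 ->
  bump rho (proj (a%:R ^+ m * b%:R ^+ n * psi u)) <=
    \1_(near_int (a ^ (m - scale k) * b ^ n) (2 * rho)) u.
Proof.
move=> Lm mnh u01 hrho rho1.
have rho0 : 0 < rho by apply: lt_le_trans hrho; exact: expaV_gt0.
have [far|] := leP rho (mdist (proj (a%:R ^+ m * b%:R ^+ n * psi u)) 0).
  by rewrite bump_far.
move=> /mdist_proj0_lt[z zlt].
have [|y /intrP[y' ->] ylt] := monomial_padding_approx Lm mnh (u := u).
  by case/andP: u01.
rewrite indicE mem_set ?bump_le1//.
apply: (@near_intP _ _ _ _ (z - y')) => //.
- by rewrite mulr_gt0.
- by rewrite muln_gt0 !expn_gt0; apply/andP; split; apply/orP; left; lia.
- rewrite intrB; set A := _%:R * u in ylt *; set B := _ * psi u in ylt zlt.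
  move: zlt ylt; rewrite !ltr_norml ler_norml => /andP[? ?] /andP[? ?].
  by apply/andP; split; lra.
Qed.

Lemma box_sum_ge (g : nat -> nat -> R) (c : R) N L p r :
  (forall m n, 0 <= g m n) -> (L + p <= N)%N -> (r <= N)%N ->
  (forall i n, (i < p)%N -> (n < r)%N -> c <= g (L + i)%N n) ->
  c * p%:R * r%:R <= \sum_(m < N) \sum_(n < N) g m n.
Proof.
move=> g0 LN rN cg.
have row m : (forall n, (n < r)%N -> c <= g m n) -> c * r%:R <= \sum_(n < N) g m n.
  move=> cgm; rewrite -(big_mkord xpredT (g m)) (big_cat_nat (leq0n r) rN)/=.
  apply: ler_wpDr; first exact: sumr_ge0.
  rewrite big_mkord; apply: (@le_trans _ _ (\sum_(n < r) c)).
    by rewrite sumr_const card_ord mulr_natr.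
  by apply: ler_sum => n _; exact: cgm.
rewrite -(big_mkord xpredT (fun m => \sum_(n < N) g m n)).
have s0 x y : 0 <= \sum_(x <= m < y) \sum_(n < N) g m n.
  by apply: sumr_ge0 => m _; exact: sumr_ge0.
rewrite (big_cat_nat (leq0n (L + p)%N) LN)/=; apply: ler_wpDr => //.
rewrite (big_cat_nat (leq0n L) (leq_addr p L))/=; apply: ler_wpDl => //.
rewrite -{1}[L]add0n big_addn addKn big_mkord.
apply: (@le_trans _ _ (\sum_(i < p) (c * r%:R))).
  by rewrite sumr_const card_ord -[leRHS]mulr_natr mulrAC.
by apply: ler_sum => i _; apply: row => n nr; rewrite addnC; exact: cg.
Qed.

Lemma box_sum_le (g g' : nat -> nat -> R) N L :
  (forall m n, g m n <= 1) -> (forall m n, 0 <= g' m n) -> (L <= N)%N ->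
  (forall m n, (L <= m < N)%N -> (n < N)%N -> g m n <= g' m n) ->
  \sum_(m < N) \sum_(n < N) g m n <=
    L%:R * N%:R + \sum_(m < N) \sum_(n < N) g' m n.
Proof.
move=> g1 g'0 LN gg'.
have -> : L%:R * N%:R = \sum_(m < N) (if (m < L)%N then N%:R else 0) :> R.
  rewrite -big_mkcond/= -(big_ord_widen N (fun=> N%:R : R) LN).
  by rewrite sumr_const card_ord mulr_natl.
rewrite -big_split/=; apply: ler_sum => m _; case: ifPn => [mL|]; last first.
  rewrite -leqNgt => Lm; rewrite add0r; apply: ler_sum => n _.
  by apply: gg'; rewrite ?Lm/=.
apply: ler_wpDr; first exact: sumr_ge0.
apply: (@le_trans _ _ (\sum_(n < N) 1)); first exact: ler_sum.
by rewrite sumr_const card_ord.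
Qed.

End Oscillation.

(** The share of a box of size [b * side k] by [side k] in the square of all
exponents below [q.+1 * scale b k]; it does not depend on [k]. *)
Definition near_density (R : realType) (b q : nat) : R := (16 * b%:R * q.+1%:R ^+ 2)^-1.

Lemma near_density_gt0 (R : realType) b q : (0 < b)%N -> 0 < near_density R b q.
Proof. by move=> b0; rewrite invr_gt0 !mulr_gt0 ?exprn_gt0 ?ltr0n. Qed.

Lemma near_density_le1 (R : realType) b q : (0 < b)%N -> near_density R b q <= 1.
Proof.
move=> b0; rewrite invf_le1 ?mulr_gt0 ?exprn_gt0 ?ltr0n//.
by rewrite -natrX -!natrM ler1n !muln_gt0 b0 ?expn_gt0.
Qed.

Section Averages.
Context {R : realType} (a b q : nat).
Hypothesis a2 : (2 <= a)%N.
Hypothesis b2 : (2 <= b)%N.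
Implicit Types (u rho : R) (k m n h : nat).
Local Notation mu := (@lebesgue_measure R).
Local Notation dens := (near_density R b q).
Local Notation psi := (padding a q (scale b)).

Let scale_lt k : (scale b k < scale b k.+1)%N.
Proof. by apply: scale_ltS; apply: ltnW. Qed.

Definition bump_avg rho u N : R := N%:R ^- 2 * \sum_(m < N) \sum_(n < N)
  bump rho (iter m (times a) (iter n (times b) (proj (psi u)))).

(** Letting [m] run through [b * side k] places from the start of the run, and
[n] below [side k], keeps [m + b * n] below the end of the run by a margin [h];
there the bump is at least [1/2]. *)
Lemma bump_avg_near rho u k h : 0 < rho -> (a%:R ^+ h)^-1 <= rho / 2 ->
  (scale b k.-1 + h <= 2 * (b * side k))%N ->
  dens / 2 <= bump_avg rho u (q.+1 * scale b k).
Proof.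
move=> rho0 hrho kh; set N := (q.+1 * scale b k)%N.
have V0 := side_gt0 k.
have N0 : (0 : R) < N%:R by rewrite ltr0n /N /scale; nia.
rewrite /bump_avg [leRHS]mulrC ler_pdivlMr ?exprn_gt0//.
apply: le_trans (@box_sum_ge R (fun m n => bump rho (iter m (times a) (iter n (times b) (proj (psi u)))))
  2^-1 N (q * scale b k + scale b k.-1) (b * side k) (side k) _ _ _ _).
- rewrite /near_density /N /scale !natrM le_eqVlt; apply/predU1P; left.
  by field; rewrite addrC natr1 !pnatr_eq0; apply/andP; split; lia.
- by move=> m n; exact: bump_ge0.
- by rewrite /N mulSn /scale; move: kh; rewrite /scale; nia.
- by rewrite /N /scale; nia.
- move=> i n ip nr; rewrite iter_times; apply: bump_near => //.
  apply: le_trans hrho; apply: mdist_monomial_near => //; first exact: leq_addr.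
  by rewrite mulSn; move: kh; rewrite /scale; nia.
Qed.

(** The integers [a ^ (m - scale b k) * b ^ n] describe the orbit of [psi u]
between the [k]-th run and the next one, and each of them brings [u] within
[2 * rho] of an integer with probability at most [8 * rho].  For
[m < scale b k] the truncated subtraction leaves the positive integer [b ^ n],
to which the same bound applies. *)
Definition typical rho k : set R :=
  let s := [seq (m, n) | m <- iota 0 (side k.+1), n <- iota 0 (side k.+1)] in
  `[0, 1[%classic `&` [set u | \sum_(p <- s)
     \1_(near_int (a ^ (p.1 - scale b k) * b ^ p.2) (2 * rho)) u < 2 * (8 * rho) * (size s)%:R].

Lemma typical_measure rho k : 0 < rho ->
  measurable (typical rho k) /\ ((2^-1)%:E <= mu (typical rho k))%E.
Proof.
move=> rho0; apply: markov_count; first by rewrite size_allpairs !size_iota muln_gt0 side_gt0.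
- by rewrite mulr_gt0.
- by move=> p; exact: measurable_near_int.
- move=> p; apply: le_trans (mu_near_int _ _) _.
  + by rewrite muln_gt0 !expn_gt0 (ltnW a2) (ltnW b2).
  + by rewrite mulr_ge0// ltW.
  + by rewrite lee_fin; lra.
Qed.

(** The first term bounds the proportion of the [m] before the end of the [k]-th
run, which tends to [0] as the scales separate. *)
Lemma bump_avg_typical rho u k h : (0 < q)%N -> 0 < rho -> 2 * rho <= 1 ->
  (a%:R ^+ h)^-1 <= rho -> (h <= k)%N -> (4 * b * q.+1 <= k.+2)%N ->
  typical rho k u ->
  bump_avg rho u (side k.+1) <= (4 * b * q.+1)%:R / k.+2%:R + 16 * rho.
Proof.
move=> q0 rho0 rho1 hrho hk bk [u01 Fu]; set N := side k.+1.
have N0 : (0 : R) < N%:R by rewrite ltr0n side_gt0.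
have Lk : (q.+1 * scale b k <= N)%N.
  by rewrite /N sideS /scale; have := side_gt0 k; nia.
rewrite /bump_avg [leLHS]mulrC ler_pdivrMr ?exprn_gt0//.
pose g' m n : R := \1_(near_int (a ^ (m - scale b k) * b ^ n) (2 * rho)) u.
apply: le_trans (@box_sum_le R (fun m n => bump rho (iter m (times a) (iter n (times b) (proj (psi u)))))
  g' N (q.+1 * scale b k) _ _ Lk _) _.
- by move=> m n; exact: bump_le1.
- by move=> m n; rewrite /g' indicE.
- move=> m n /andP[Lm mN] nN; rewrite iter_times.
  apply: (bump_le_indic a2 b2 (h := h)) => //.
  by have := ltn_side k.+1; rewrite -/N /scale -/N; nia.
move: Fu; rewrite /= size_allpairs !size_iota big_allpairs/=.
have -> : \sum_(m <- iota 0 N) \sum_(n <- iota 0 N)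
     \1_(near_int (a ^ (m - scale b k) * b ^ n) (2 * rho)) u = \sum_(m < N) \sum_(n < N) g' m n.
  rewrite -(big_mkord xpredT (fun m => \sum_(n < N) g' m n)) /index_iota subn0.
  by apply: eq_bigr => m _; rewrite -(big_mkord xpredT (g' m)) /index_iota subn0.
move=> Fu; apply: (@le_trans _ _ ((q.+1 * scale b k)%:R * N%:R + 16 * rho * N%:R ^+ 2)).
  by rewrite lerD2l ltW//; apply: (lt_le_trans Fu); rewrite natrM expr2; lra.
rewrite [leRHS]mulrDl lerD2r /N sideS expr2 /scale !natrM.
rewrite le_eqVlt; apply/predU1P; left; field.
by rewrite gt_eqF//; have := ler0n R k; lra.
Qed.

Lemma expaV_small (e : R) : 0 < e -> exists h, (a%:R ^+ h)^-1 <= e.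
Proof.
move=> e0; exists (Num.bound e^-1); rewrite -[leRHS]invrK lef_pV2 ?posrE ?expa_gt0 ?invr_gt0//.
apply: ltW; apply: lt_le_trans (upper_nthrootP (leqnn _)) _.
by apply: lerXn2r; rewrite ?nnegrE ?ler0n ?ler_nat.
Qed.

(** At infinitely many times the average is at least [dens / 2], and at
infinitely many others at most [dens / 4]. *)
Lemma empirical_diverges rho u : (0 < q)%N -> 0 < rho -> 128 * rho <= dens ->
  lim_sup_set (typical rho) u ->
  ~ exists nu : probability (torus R) R,
      (fun N : nat => empirical_measure a b (proj (psi u)) N.+1 : probability (torus R) R)
        @ \oo --> nu.
Proof.
move=> q0 rho0 rhof limu [nu /weak_star_cvgP/(_ _ (continuous_bump rho0))].
have f0 : 0 < dens by apply: near_density_gt0; apply: ltnW.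
have f1 : dens <= 1 by apply: near_density_le1; apply: ltnW.
move/cvgrPdist_lt => /(_ (dens / 16)) [|n0 _ conv]; first by rewrite divr_gt0.
set l := \int[nu]_x bump rho x in conv.
have {}conv N : (n0 < N)%N -> `|l - bump_avg rho u N| < dens / 16.
  case: N => // N n0N; have := conv N n0N.
  by rewrite /= Rintegral_empirical//; [exact: continuous_bump|exact: bump_ge0].
have [h hrho] : exists h, (a%:R ^+ h)^-1 <= rho / 2 by apply: expaV_small; rewrite divr_gt0.
(* [K] makes the proportion of early exponents at most [dens / 8]; the
   requirement [h < k] leaves room for the margin [h] at the end of the run. *)
pose K := Num.bound ((4 * b * q.+1)%:R / (dens / 8)).
have [k /= Kk tk] := limu (maxn n0 (maxn h.+3 (maxn K (4 * b * q.+1)))) I.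
move: Kk; rewrite !geq_max => /and4P[n0k hk Kk bk].
have near_k : dens / 2 <= bump_avg rho u (q.+1 * scale b k).
  apply: (bump_avg_near u rho0 hrho).
  case: k hk {n0k Kk bk tk} => // k hk /=; rewrite /scale sideS.
  have h1 : (h <= b * (k * side k))%N.
    have hk' : (h <= k)%N by lia.
    apply: (leq_trans hk'); apply: leq_trans (leq_pmulr k (side_gt0 k)) _.
    by apply: leq_pmull; apply: ltnW.
  have -> : (2 * (b * (k.+2 * side k)) = 4 * b * side k + 2 * (b * (k * side k)))%N by lia.
  by rewrite leq_add2l; lia.
have typ_k : bump_avg rho u (side k.+1) <= dens / 4.
  apply: le_trans (@bump_avg_typical rho u k h q0 rho0 _ _ _ _ tk) _.
  - by lra.
  - by lra.
  - by lia.
  - by lia.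
  - have -> : dens / 4 = dens / 8 + dens / 8 by lra.
    apply: lerD; last by lra.
    rewrite ler_pdivrMr ?ltr0n// mulrC -ler_pdivrMr ?divr_gt0//.
    apply: le_trans (ltW (archi_boundP _)) _; first by rewrite divr_ge0 ?ler0n// ltW// divr_gt0.
    by rewrite ler_nat; apply: leq_trans Kk _; lia.
have c1 : `|l - bump_avg rho u (q.+1 * scale b k)| < dens / 16.
  by apply: conv; rewrite /scale; have := ltn_side k; nia.
have c2 : `|l - bump_avg rho u (side k.+1)| < dens / 16.
  by apply: conv; have := ltn_side k.+1; lia.
move: c1 c2; rewrite !ltr_norml => /andP[? ?] /andP[? ?]; lra.
Qed.

(** For distances at most [1], any exponent [s <= q / (q + 1)] is weaker than
[q / (q + 1)]. *)
Lemma torus_padding_lower_holder u v s : (0 < q)%N -> 0 <= s -> s * q.+1%:R <= q%:R ->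
  0 <= u < 1 -> 0 <= v < 1 ->
  `|u - v| <= 2 * (a%:R ^+ (q * scale b 0) * 2 ^+ q) *
     mdist (proj (psi u)) (proj (psi v)) `^ s.
Proof.
move=> q0 s0 sq; wlog uv : u v / u <= v => [hw|] u01 v01.
  have [/hw|/ltW /hw] := leP u v; first exact.
  by rewrite distrC metric_sym; exact.
have psi01 (w : R) : 0 <= w < 1 -> 0 <= psi w <= 2^-1.
  move=> /andP[w0 w1]; apply/andP; split; first exact: padding_ge0.
  apply: padding_le_half => //; last by rewrite w0 ltW.
  by rewrite /scale muln_gt0 side_gt0 muln_gt0/= ltnW.
have psi_uv : psi u <= psi v.
  rewrite -subr_ge0; apply: le_trans (padding_gap q a2 scale_lt 0 uv).
  by rewrite mulr_ge0 ?subr_ge0 ?truncate_homo// invr_ge0 mulr_ge0// ltW ?expa_gt0.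
have D_half : psi v - psi u <= 2^-1.
  by move: (psi01 u u01) (psi01 v v01) => /andP[? ?] /andP[? ?]; lra.
have gap := padding_lower_holder a2 scale_lt q0 uv.
rewrite distrC ger0_norm ?subr_ge0// metric_sym mdist_proj ger0_norm ?subr_ge0//.
set D := psi v - psi u in D_half gap *; set C := _ * 2 ^+ q.
have D0 : 0 <= D by rewrite subr_ge0.
have C1 : 1 <= C by rewrite /C -!natrX -natrM ler1n muln_gt0 !expn_gt0/= (ltnW a2).
have {}gap : ((v - u) / 2) ^+ q.+1 <= C * D ^+ q.
  rewrite /C -mulrA -exprMn; apply: gap.
  by move: u01 v01 => /andP[? ?] /andP[? ?]; lra.
suff : (v - u) / 2 <= C * D `^ s by lra.
rewrite -(@ler_pXn2r _ q.+1)// ?nnegrE ?mulr_ge0 ?powR_ge0 ?subr_ge0//.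
apply: (le_trans gap); rewrite exprMn; apply: ler_pM; rewrite ?exprn_ge0//.
- exact: le_trans ler01 C1.
- by rewrite exprS ler_peMr ?exprn_ege1// (le_trans ler01 C1).
- rewrite -(powR_mulrn q D0) (_ : (D `^ s) ^+ q.+1 = D `^ (s * q.+1%:R)); last first.
    by rewrite -powR_mulrn ?powR_ge0// powRrM.
  have [->|Dn0] := eqVneq D 0.
    by rewrite powR0 ?pnatr_eq0 -?lt0n// powR_ge0.
  by apply: ger_powR => //; rewrite lt_neqAle eq_sym Dn0 D0 /=; lra.
Qed.

End Averages.

Theorem theorem1p4 (R : realType) (a b : nat) (ha : (2 <= a)%N) (hb : (2 <= b)%N) :
  hausdorff_dim
    [set x : torus R |
      ~ exists mu : probability (torus R) R,
          [/\ times_invariant a mu, times_invariant b mu &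
              (fun N : nat => empirical_measure a b x N.+1 : probability (torus R) R)
                @ \oo --> mu]]
  = 1%E.
Proof.
apply/eqP; rewrite eq_le hausdorff_dim_torus_le1/=.
apply: le_ereal_inf_tmp => _ [s [s0 Hs0] <-]; rewrite lee_fin leNgt.
apply/negP => s1.
have [q q0 qs] : exists2 q, (0 < q)%N & s * q.+1%:R <= q%:R.
  exists (Num.bound (s / (1 - s))).+1 => //; set q := (Num.bound _).+1.
  have : s / (1 - s) < q%:R.
    apply: lt_le_trans (archi_boundP _) _; first by rewrite divr_ge0// subr_ge0 ltW.
    by rewrite ler_nat leqnSn.
  by rewrite ltr_pdivrMr ?subr_gt0// -natr1; lra.
(* The typical averages are at most [near_density / 8 + 16 * rho], which this
   choice makes [near_density / 4], half of the averages after a run. *)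
pose rho : R := near_density R b q / 128.
have rho0 : 0 < rho by rewrite divr_gt0// near_density_gt0// ltnW.
pose G := lim_sup_set (typical a b rho).
have [mT muT] : (forall k, measurable (typical a b rho k)) /\
    (forall k, ((2^-1)%:E <= lebesgue_measure (typical a b rho k))%E).
  by split=> k; case: (typical_measure ha hb k rho0).
have mG : measurable G by apply: bigcap_measurable => // n _; exact: bigcup_measurable.
have muG : ((2^-1)%:E <= lebesgue_measure G)%E.
  by apply: limsup_measure_ge => // k u [].
have G01 u : G u -> 0 <= u < 1.
  by move=> /(_ 0%N I)[k _ []]; rewrite /= in_itv.
apply: (@hausdorff_measure_neq0 _ _ (fun u => proj (padding a q (scale b) u)) G _ s
   (2 * (a%:R ^+ (q * scale b 0) * 2 ^+ q)) (2^-1)) Hs0 => //.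
- by rewrite !mulr_gt0 ?exprn_gt0 ?ltr0n ?(ltnW ha).
- move=> _ [u Gu <-] /= [nu [_ _ conv]].
  apply: (empirical_diverges ha hb q0 rho0 _ Gu); last by exists nu.
  by rewrite /rho mulrC divfK.
- by move=> u v /G01 u01 /G01 v01; exact: torus_padding_lower_holder.
Qed.
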